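(* There are no minimal Lorentz meridian surfaces lying fully in $\mathbb{E}^4_2$; that is, every minimal Lorentz meridian surface in $\mathbb{E}^4_2$ is contained in an (affine) hyperplane of $\mathbb{E}^4_2$.
   Context: $\mathbb{E}^4_2$ is $\mathbb{R}^4$ with the inner product $\langle x,y\rangle=x_1y_1+x_2y_2-x_3y_3-x_4y_4$ and standard basis $e_1,e_2,e_3,e_4$. Put $\mathbb{E}^3_1=\mathrm{span}\{e_1,e_2,e_3\}$ and $\mathbb{E}^3_2=\mathrm{span}\{e_2,e_3,e_4\}$. Let $I,J\subset\mathbb{R}$ be open intervals, $f,g:I\to\mathbb{R}$ smooth with $f$ nowhere zero, and $l$ a smooth curve defined on $J$. A Lorentz meridian surface is a surface of one of the following types ($u\in I$, $v\in J$). With timelike axis, $z(u,v)=f(u)l(v)+g(u)e_4$, where $l$ is a curve in $\mathbb{E}^3_1$ and: - type $\mathcal{M}'_a$: $\langle l,l\rangle=1$, $\langle l',l'\rangle=1$, $f'^2-g'^2=-1$; - type $\mathcal{M}'_b$: $\langle l,l\rangle=1$, $\langle l',l'\rangle=-1$, $f'^2-g'^2=1$; - type $\mathcal{M}''$: $\langle l,l\rangle=-1$, $\langle l',l'\rangle=1$, $f'^2+g'^2=1$. With spacelike axis, $z(u,v)=g(u)e_1+f(u)l(v)$, where $l$ is a curve in $\mathbb{E}^3_2$ and: - type $\widetilde{\mathcal{M}}'$: $\langle l,l\rangle=1$, $\langle l',l'\rangle=-1$, $f'^2+g'^2=1$; - type $\widetilde{\mathcal{M}}''_a$: $\langle l,l\rangle=-1$,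 $\langle l',l'\rangle=1$, $f'^2-g'^2=1$; - type $\widetilde{\mathcal{M}}''_b$: $\langle l,l\rangle=-1$, $\langle l',l'\rangle=-1$, $f'^2-g'^2=-1$. (The coordinate map $(x_1,x_2,x_3,x_4)\mapsto(x_4,x_3,x_1,x_2)$ carries surfaces of type $\mathcal{M}''$, $\mathcal{M}'_b$, $\mathcal{M}'_a$ respectively to surfaces of type $\widetilde{\mathcal{M}}'$, $\widetilde{\mathcal{M}}''_a$, $\widetilde{\mathcal{M}}''_b$; it reverses the sign of the metric.) All these surfaces have Lorentzian induced metric. For a Lorentz surface with second fundamental form $h$, the mean curvature vector field is $H=\tfrac12\,\mathrm{tr}\,h=\tfrac12\left(h(E_1,E_1)-h(E_2,E_2)\right)$ for any local orthonormal tangent frame with $\langle E_1,E_1\rangle=1$, $\langle E_2,E_2\rangle=-1$. The surface is minimal if $H=0$ identically. A surface lies fully in $\mathbb{E}^4_2$ if it is not contained in any hyperplane. *)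

(* Defs.v *)
From HB Require Import structures.
From mathcomp Require Import all_boot all_order all_algebra.
From mathcomp Require Import all_classical all_reals all_analysis.

Set Implicit Arguments.
Unset Strict Implicit.
Unset Printing Implicit Defensive.

Import Order.TTheory GRing.Theory Num.Theory.
Import numFieldNormedType.Exports.
Local Open Scope classical_set_scope.
Local Open Scope ring_scope.

(* Coordinates are numbered from 0: x 0 k is the coordinate x_(k+1), and
   stdb k is the basis vector e_(k+1). *)
Definition inner {R : realType} (x y : 'rV[R]_4) : R :=
  x 0 0 * y 0 0 + x 0 1 * y 0 1 - x 0 2 * y 0 2 - x 0 3 * y 0 3.

Definition stdb {R : realType} (k : 'I_4) : 'rV[R]_4 := delta_mx 0 k.

Definition E31 (R : realType) : {vspace 'rV[R]_4} :=
  <<[:: stdb 0; stdb 1; stdb 2]%R>>%VS.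

Definition E32 (R : realType) : {vspace 'rV[R]_4} :=
  <<[:: stdb 1; stdb 2; stdb 3]%R>>%VS.

Definition affine_hyperplane {R : realType} (P : set 'rV[R]_4) : Prop :=
  exists (p : 'rV[R]_4) (W : {vspace 'rV[R]_4}),
    \dim W = 3%N /\ P = [set x | x - p \in W].

Definition lies_fully {R : realType} (S : set 'rV[R]_4) : Prop :=
  ~ exists P : set 'rV[R]_4, affine_hyperplane P /\ S `<=` P.

Definition open_interval {R : realType} (I : set R) : Prop :=
  [/\ open I, is_interval I & I !=set0].

(* The functions are total on R; only their values on the open set D matter. *)
Definition smooth_on {R : realType} {V : normedModType R} (D : set R)
    (f : R -> V) : Prop :=
  forall (n : nat) (x : R), D x -> derivable (derive1n n f) x 1.

Definition meridian_data {R : realType} (I J : set R) (f g : R -> R)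
    (l : R -> 'rV[R]_4) : Prop :=
  [/\ smooth_on I f, smooth_on I g, (forall u, I u -> f u != 0)
    & smooth_on J l].

Definition timelike_axis {R : realType} (f g : R -> R) (l : R -> 'rV[R]_4)
    (q : R * R) : 'rV[R]_4 :=
  f q.1 *: l q.2 + g q.1 *: stdb 3.

Definition spacelike_axis {R : realType} (f g : R -> R) (l : R -> 'rV[R]_4)
    (q : R * R) : 'rV[R]_4 :=
  g q.1 *: stdb 0 + f q.1 *: l q.2.

Definition curve_in {R : realType} (J : set R) (W : {vspace 'rV[R]_4})
    (a b : R) (l : R -> 'rV[R]_4) : Prop :=
  forall v, J v ->
    [/\ l v \in W, inner (l v) (l v) = a & inner (derive1 l v) (derive1 l v) = b].

(* In the constructor names, M1 and M2 stand for M' and M'', and the prefix T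
   stands for the tilde. *)
Inductive lorentz_meridian {R : realType} (I J : set R) :
    (R * R -> 'rV[R]_4) -> Prop :=
| M1a f g l of meridian_data I J f g l & curve_in J (E31 R) 1 1 l
    & (forall u, I u -> derive1 f u ^+ 2 - derive1 g u ^+ 2 = -1) :
    lorentz_meridian I J (timelike_axis f g l)
| M1b f g l of meridian_data I J f g l & curve_in J (E31 R) 1 (-1) l
    & (forall u, I u -> derive1 f u ^+ 2 - derive1 g u ^+ 2 = 1) :
    lorentz_meridian I J (timelike_axis f g l)
| M2 f g l of meridian_data I J f g l & curve_in J (E31 R) (-1) 1 l
    & (forall u, I u -> derive1 f u ^+ 2 + derive1 g u ^+ 2 = 1) :
    lorentz_meridian I J (timelike_axis f g l)
| TM1 f g l of meridian_data I J f g l & curve_in J (E32 R) 1 (-1) l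
    & (forall u, I u -> derive1 f u ^+ 2 + derive1 g u ^+ 2 = 1) :
    lorentz_meridian I J (spacelike_axis f g l)
| TM2a f g l of meridian_data I J f g l & curve_in J (E32 R) (-1) 1 l
    & (forall u, I u -> derive1 f u ^+ 2 - derive1 g u ^+ 2 = 1) :
    lorentz_meridian I J (spacelike_axis f g l)
| TM2b f g l of meridian_data I J f g l & curve_in J (E32 R) (-1) (-1) l
    & (forall u, I u -> derive1 f u ^+ 2 - derive1 g u ^+ 2 = -1) :
    lorentz_meridian I J (spacelike_axis f g l).

(* A pair x : R * R stands for the tangent vector 'D_x z q at the point of
   parameter q, i.e. for x.1 z_u + x.2 z_v. *)
Definition tangent_plane {R : realType} (z : R * R -> 'rV[R]_4) (q : R * R) :
    {vspace 'rV[R]_4} :=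
  <<[:: 'D_(1, 0) z q; 'D_(0, 1) z q]%R>>%VS.

(* This is the unique such vector when the metric induced on the tangent plane
   is nondegenerate. *)
Definition normal_part {R : realType} (z : R * R -> 'rV[R]_4) (q : R * R)
    (w : 'rV[R]_4) : 'rV[R]_4 :=
  xget 0 [set n | w - n \in tangent_plane z q /\
                  forall t, t \in tangent_plane z q -> inner n t = 0].

(* h(X, Y) is the normal part of the flat derivative of Y along X; by
   tensoriality Y may be extended with constant coefficients in (z_u, z_v). *)
Definition second_form {R : realType} (z : R * R -> 'rV[R]_4) (q x y : R * R) :
    'rV[R]_4 :=
  normal_part z q ('D_x (fun q' => 'D_y z q') q).

Definition orthonormal_frame {R : realType} (z : R * R -> 'rV[R]_4)
    (q x1 x2 : R * R) : Prop :=
  [/\ inner ('D_x1 z q) ('D_x1 z q) = 1,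
      inner ('D_x2 z q) ('D_x2 z q) = -1 &
      inner ('D_x1 z q) ('D_x2 z q) = 0].

Definition mean_curvature {R : realType} (z : R * R -> 'rV[R]_4)
    (q x1 x2 : R * R) : 'rV[R]_4 :=
  2^-1 *: (second_form z q x1 x1 - second_form z q x2 x2).

(* The mean curvature vector does not depend on the frame, and a frame exists
   at every point where the induced metric is Lorentzian. *)
Definition minimal {R : realType} (I J : set R) (z : R * R -> 'rV[R]_4) : Prop :=
  forall q, (I `*` J) q -> forall x1 x2, orthonormal_frame z q x1 x2 ->
    mean_curvature z q x1 x2 = 0.

(* Main.v *)
Require Import Defs.
From mathcomp Require Import all_boot all_order all_algebra.
From mathcomp Require Import all_classical all_reals all_analysis.
From mathcomp Require Import ring lra.
Set Implicit Arguments.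
Unset Strict Implicit.
Unset Printing Implicit Defensive.
Import Order.TTheory GRing.Theory Num.Theory.
Import numFieldNormedType.Exports.
Local Open Scope classical_set_scope.
Local Open Scope ring_scope.

(* In all six types z = f l + g e with e a basis vector orthogonal to l, the
   vectors z_u and z_v are orthogonal and <z_u, z_u> = - <l', l'>.  In the frame
   formed by z_u and z_v / f, minimality at a point says that
   z_uu - z_vv / f^2 = f'' l + g'' e - l'' / f is tangent, so that l'' lies in
   span (l, l', e).  Differentiating <l', l'> = +-1 and <l, e> = 0 removes the
   components along l' and e: l'' is parallel to l.  Then l /\ l' is constant,
   l stays in the plane spanned by l (v0) and l' (v0), and z stays in the
   hyperplane spanned by this plane and e. *)

(** * Calculus along lines and on intervals *)

Lemma is_derive_mxP (R : realFieldType) (V : normedModType R) (m n : nat)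
    (M : V -> 'M[R]_(m, n)) (t v : V) (D : 'M[R]_(m, n)) :
  is_derive t v M D <->
  forall i j, is_derive t v (fun x => M x i j) (D i j).
Proof.
split=> [[Mt <-] i j|Mt].
  split; first exact: (derivable_mxP _ _ _).1.
  by rewrite derive_mx // mxE.
have dM : derivable M t v by apply/derivable_mxP => i j; have [] := Mt i j.
split=> //; rewrite derive_mx //; apply/matrixP => i j; rewrite mxE.
by have [_ <-] := Mt i j.
Qed.

(** In one variable the differential is linear in the direction. A general [c] is wanted because the
    unit vector along z_v has parameter direction (0, 1 / f). *)
Lemma is_derive_derive1 (R : numFieldType) (V : normedModType R) (f : R -> V)
    (x c : R) :
  derivable f x 1 -> is_derive x c f (c *: derive1 f x).
Proof.
move=> /derivable1_diffP df; split; first by apply: diff_derivable; exact: df.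
by rewrite derive1E !deriveE // -linearZ /= [c *: 1]mulr1.
Qed.

(** Both sides are limits of one and the same difference quotient. *)
Lemma derive_fst (R : numFieldType) (V : normedModType R) (F : R * R -> V)
    (u v : R) :
  'D_(1, 0) F (u, v) = 'D_1 (fun s => F (s, v)) u.
Proof.
rewrite /derive; set G := fun h => _; set G' := fun h => _.
suff -> : G = G' by []; apply/funext => h; rewrite /G /G' /=.
rewrite (_ : h *: (1, 0) + (u, v) = (h *: 1 + u, v))//.
by apply: injective_projections; rewrite //= scaler0 add0r.
Qed.

Lemma derive_snd (R : numFieldType) (V : normedModType R) (F : R * R -> V)
    (u v c : R) :
  'D_(0, c) F (u, v) = 'D_c (fun t => F (u, t)) v.
Proof.
rewrite /derive; set G := fun h => _; set G' := fun h => _.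
suff -> : G = G' by []; apply/funext => h; rewrite /G /G' /=.
rewrite (_ : h *: (0, c) + (u, v) = (u, h *: c + v))//.
by apply: injective_projections; rewrite //= scaler0 add0r.
Qed.

Lemma is_derive_scalel (R : realType) (n : nat) (f : R -> R) (w : 'rV[R]_n)
    (x v df : R) :
  is_derive x v f df -> is_derive x v (fun s => f s *: w) (df *: w).
Proof.
move=> fdf; apply/is_derive_mxP => i j.
rewrite mxE (_ : (fun _ => _) = w i j \*: f); last first.
  by apply/funext => s; rewrite mxE mulrC.
by rewrite mulrC; exact: is_deriveZ.
Qed.

Lemma derive1_zero_cst (R : realType) (I : set R) (f : R -> R) :
  is_interval I -> (forall x, I x -> is_derive x 1 f 0) ->
  forall x y, I x -> I y -> f x = f y.
Proof.
move=> Iitv df; suff le_cst x y : I x -> I y -> x <= y -> f x = f y.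
  by move=> x y Ix Iy; have [/le_cst->|/ltW/le_cst->] := leP x y.
move=> Ix Iy xy.
have dfI t : x <= t <= y -> is_derive t 1 f 0 by move=> /(Iitv _ _ Ix Iy) /df.
have df_oo t : t \in `]x, y[%R -> is_derive t 1 f (cst 0 t).
  by rewrite in_itv => /andP[xt ty]; apply: dfI; rewrite !ltW.
have cf : {within `[x, y], continuous f}.
  by apply: derivable_within_continuous => t; rewrite in_itv => /dfI[].
have [c _] := MVT_segment xy df_oo cf.
by rewrite mul0r => /eqP; rewrite subr_eq0 => /eqP.
Qed.

(** As [J] is open, [f] agrees with a constant near [v]. This differentiates the constraints on l,
    which hold only on [J]. *)
Lemma derive_cst_on (R : realFieldType) (V : normedModType R) (J : set R)
    (f : R -> V) (w df : V) (v : R) :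
  open J -> J v -> (forall t, J t -> f t = w) -> is_derive v 1 f df -> df = 0.
Proof.
move=> oJ Jv fw [_ <-]; rewrite (near_eq_derive (g := cst w)) ?derive_cst//.
by near do apply: fw; exact: open_nbhs_nbhs.
Unshelve. all: by end_near. Qed.

(** * Linear algebra of the indefinite inner product *)

(** Turns membership in [E31] or [E32] into the vanishing of the coordinate along the axis. *)
Lemma span_coord0 (R : realType) (n : nat) (k : 'I_n) (X : seq 'rV[R]_n) x :
  (forall y, y \in X -> y 0 k = 0) -> x \in <<X>>%VS -> x 0 k = 0.
Proof.
move=> X0 xX; rewrite (@coord_span _ _ _ (in_tuple X) _ xX) summxE.
by rewrite big1// => i _; rewrite mxE X0 ?mulr0// mem_nth.
Qed.

Lemma innerC (R : realType) (x y : 'rV[R]_4) : inner x y = inner y x.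
Proof. by rewrite /inner; ring. Qed.

Lemma innerDl (R : realType) (x y w : 'rV[R]_4) :
  inner (x + y) w = inner x w + inner y w.
Proof. by rewrite /inner !mxE; ring. Qed.

Lemma innerZl (R : realType) (c : R) (x w : 'rV[R]_4) :
  inner (c *: x) w = c * inner x w.
Proof. by rewrite /inner !mxE; ring. Qed.

Lemma innerBl (R : realType) (x y w : 'rV[R]_4) :
  inner (x - y) w = inner x w - inner y w.
Proof. by rewrite -scaleN1r innerDl innerZl mulN1r. Qed.

Lemma innerDr (R : realType) (x y w : 'rV[R]_4) :
  inner w (x + y) = inner w x + inner w y.
Proof. by rewrite !(innerC w) innerDl. Qed.

Lemma innerZr (R : realType) (c : R) (x w : 'rV[R]_4) :
  inner w (c *: x) = c * inner w x.
Proof. by rewrite !(innerC w) innerZl. Qed.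

Lemma inner_stdb (R : realType) (x : 'rV[R]_4) (k : 'I_4) :
  inner x (stdb k) = x 0 k * inner (stdb k) (stdb k : 'rV[R]_4).
Proof.
have : k \in [:: 0; 1; 2; 3] by case: k => -[|[|[|[|]]]].
by rewrite !inE => /or4P[] /eqP->; rewrite /inner !mxE /=; ring.
Qed.

Lemma is_derive_inner (R : realType) (l m : R -> 'rV[R]_4) (v : R)
    (dl dm : 'rV[R]_4) :
  is_derive v 1 l dl -> is_derive v 1 m dm ->
  is_derive v 1 (fun t => inner (l t) (m t)) (inner dl (m v) + inner (l v) dm).
Proof.
move=> /is_derive_mxP/(_ 0) dL /is_derive_mxP/(_ 0) dM.
pose L i t := l t 0 i; pose M i t := m t 0 i.
have dLM i : is_derive v 1 (L i * M i) (L i v * dm 0 i + M i v * dl 0 i).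
  exact: is_deriveM (dL i) (dM i).
have dI := is_deriveB (is_deriveB (is_deriveD (dLM 0) (dLM 1)) (dLM 2)) (dLM 3).
by apply: (is_derive_eq dI); rewrite /inner /L /M; ring.
Qed.

Lemma mem_span2P (F : fieldType) (V : vectType F) (x a b : V) :
  reflect (exists s t, x = s *: a + t *: b) (x \in <<[:: a; b]>>%VS).
Proof.
rewrite span_cons span_seq1; apply: (iffP memv_addP).
  by move=> [_ /vlineP[s ->] [_ /vlineP[t ->] ->]]; exists s, t.
by move=> [s [t ->]]; exists (s *: a); [|exists (t *: b)] => //; apply/vlineP;
  eexists.
Qed.

Lemma orthogonal_projection (R : realType) (x y w : 'rV[R]_4) :
  inner x x != 0 -> inner y y != 0 -> inner x y = 0 ->
  exists n, w - n \in <<[:: x; y]>>%VS /\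
    forall t, t \in <<[:: x; y]>>%VS -> inner n t = 0.
Proof.
move=> x0 y0 xy.
(* Gram-Schmidt: the components along [x] and [y] are removed, which is possible since neither
   vector is null. *)
exists (w - (inner w x / inner x x *: x + inner w y / inner y y *: y)); split.
  by rewrite subKr; apply/mem_span2P; do 2 eexists.
move=> _ /mem_span2P[s [t ->]].
rewrite innerBl innerDl !innerDr !innerZl !innerZr (innerC y x) xy.
by field; rewrite x0 y0.
Qed.

(** [normal_part] is a choice with default value 0; the orthogonal projection shows that a normal
    component exists, so the chosen vector has its defining property. *)
Lemma sub_normal_part (R : realType) (z : R * R -> 'rV[R]_4) (q : R * R) w :
  inner ('D_(1, 0) z q) ('D_(1, 0) z q) != 0 ->
  inner ('D_(0, 1) z q) ('D_(0, 1) z q) != 0 ->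
  inner ('D_(1, 0) z q) ('D_(0, 1) z q) = 0 ->
  w - normal_part z q w \in tangent_plane z q.
Proof.
move=> X0 Y0 XY.
by have [] := xgetPex 0 (orthogonal_projection w X0 Y0 XY).
Qed.

(** Pairing a vanishing combination with each vector in turn isolates one coefficient times a
    nonzero square norm. *)
Lemma free3_orthogonal (R : realType) (x y w : 'rV[R]_4) :
  inner x x != 0 -> inner y y != 0 -> inner w w != 0 ->
  inner x y = 0 -> inner x w = 0 -> inner y w = 0 -> free [:: x; y; w].
Proof.
move=> x0 y0 w0 xy xw yw.
apply/(@freeP _ _ _ [tuple x; y; w]) => k.
rewrite !big_ord_recl big_ord0 addr0 /= => kE.
have kI u : inner (k ord0 *: x + (k (lift ord0 ord0) *: y +
    k (lift ord0 (lift ord0 ord0)) *: w)) u = 0.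
  by rewrite kE /inner !mxE; ring.
have k0 : k ord0 = 0.
  apply/eqP; have /eqP := kI x; rewrite !innerDl !innerZl (innerC y) (innerC w).
  by rewrite xy xw !mulr0 !addr0 mulf_eq0 (negbTE x0) orbF.
have k1 : k (lift ord0 ord0) = 0.
  apply/eqP; have /eqP := kI y; rewrite !innerDl !innerZl (innerC w).
  by rewrite xy yw !mulr0 addr0 add0r mulf_eq0 (negbTE y0) orbF.
have k2 : k (lift ord0 (lift ord0 ord0)) = 0.
  apply/eqP; have /eqP := kI w; rewrite !innerDl !innerZl.
  by rewrite xw yw !mulr0 !add0r mulf_eq0 (negbTE w0) orbF.
move=> i; case: (unliftP ord0 i) => [j ->|->//].
case: (unliftP ord0 j) => [j' ->|->//].
by rewrite (ord1 j').
Qed.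

(** * First and second derivatives of a meridian surface *)

(** Common form of both families: [e] is [stdb 3] for a timelike axis and [stdb 0] for a spacelike
    one. *)
Definition meridian_surface (R : realType) (f g : R -> R) (l : R -> 'rV[R]_4)
    (e : 'rV[R]_4) (q : R * R) : 'rV[R]_4 :=
  f q.1 *: l q.2 + g q.1 *: e.

Lemma is_derive_eq_derive (R : numFieldType) (V W : normedModType R)
    (f : V -> W) (x v : V) (df : W) :
  is_derive x v f df -> 'D_v f x = df.
Proof. by case. Qed.

Lemma smooth_on_derive1 (R : realType) (V : normedModType R) (D : set R)
    (f : R -> V) :
  smooth_on D f -> smooth_on D (derive1 f).
Proof. by move=> fD n x Dx; move: (fD n.+1 x Dx); rewrite /derive1n iterSr. Qed.

Lemma smooth_on_is_derive (R : realType) (V : normedModType R) (D : set R)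
    (f : R -> V) (x c : R) :
  smooth_on D f -> D x -> is_derive x c f (c *: derive1 f x).
Proof. by move=> fD Dx; apply: is_derive_derive1; exact: (fD 0%N x Dx). Qed.

Lemma derive1_on (R : realType) (V : normedModType R) (D : set R)
    (f : R -> V) (x : R) :
  smooth_on D f -> D x -> is_derive x 1 f (derive1 f x).
Proof.
by move=> fD Dx; have := smooth_on_is_derive 1 fD Dx; rewrite scale1r.
Qed.

Lemma meridian_u (R : realType) (I J : set R) (f g : R -> R)
    (l : R -> 'rV[R]_4) (e : 'rV[R]_4) (u v : R) :
  meridian_data I J f g l -> I u ->
  'D_(1, 0) (meridian_surface f g l e) (u, v) =
  derive1 f u *: l v + derive1 g u *: e.
Proof.
move=> [fS gS _ _] Iu.
rewrite derive_fst; apply: is_derive_eq_derive; rewrite /meridian_surface /=.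
by apply: is_deriveD; apply: is_derive_scalel;
  [exact: derive1_on fS Iu|exact: derive1_on gS Iu].
Qed.

Lemma meridian_v (R : realType) (I J : set R) (f g : R -> R)
    (l : R -> 'rV[R]_4) (e : 'rV[R]_4) (c u v : R) :
  meridian_data I J f g l -> J v ->
  'D_(0, c) (meridian_surface f g l e) (u, v) = (c * f u) *: derive1 l v.
Proof.
move=> [_ _ _ lS] Jv.
rewrite derive_snd; apply: is_derive_eq_derive; rewrite /meridian_surface /=.
have dl := smooth_on_is_derive c lS Jv.
have := is_deriveD (is_deriveZ (f u) dl) (is_derive_cst (g u *: e) v c).
by rewrite addr0 scalerA mulrC.
Qed.

Lemma meridian_uu (R : realType) (I J : set R) (f g : R -> R)
    (l : R -> 'rV[R]_4) (e : 'rV[R]_4) (u v : R) :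
  meridian_data I J f g l -> open I -> I u ->
  'D_(1, 0) (fun q => 'D_(1, 0) (meridian_surface f g l e) q) (u, v) =
  derive1 (derive1 f) u *: l v + derive1 (derive1 g) u *: e.
Proof.
move=> zS oI Iu; have [/smooth_on_derive1 fS /smooth_on_derive1 gS _ _] := zS.
rewrite derive_fst.
(* The formula for z_u is known only for parameters in [I]; openness makes it valid near [u], which
   is enough to differentiate it. *)
rewrite (near_eq_derive (g := fun s => derive1 f s *: l v + derive1 g s *: e)).
  apply: is_derive_eq_derive.
  by apply: is_deriveD; apply: is_derive_scalel;
  [exact: derive1_on fS Iu|exact: derive1_on gS Iu].
by near do apply: meridian_u zS _; exact: open_nbhs_nbhs.
Unshelve. all: by end_near. Qed.

Lemma meridian_vv (R : realType) (I J : set R) (f g : R -> R)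
    (l : R -> 'rV[R]_4) (e : 'rV[R]_4) (c u v : R) :
  meridian_data I J f g l -> open J -> J v ->
  'D_(0, c) (fun q => 'D_(0, c) (meridian_surface f g l e) q) (u, v) =
  (c ^+ 2 * f u) *: derive1 (derive1 l) v.
Proof.
move=> zS oJ Jv; have [_ _ _ /smooth_on_derive1 lS] := zS.
rewrite derive_snd.
rewrite (near_eq_derive (g := fun t => (c * f u) *: derive1 l t)).
  have dl := smooth_on_is_derive c lS Jv.
  by have [_ ->] := is_deriveZ (c * f u) dl; rewrite scalerA mulrAC expr2.
by near do apply: meridian_v zS _; exact: open_nbhs_nbhs.
Unshelve. all: by end_near. Qed.

(** * Minimality at a point *)

(** The last hypothesis unifies the profile equations of the six types: it says that <z_u, z_u> =
    -b, so z_u and z_v / f are unit vectors of opposite causal character. *)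
Lemma minimal_meridian (R : realType) (I J : set R) (f g : R -> R)
    (l : R -> 'rV[R]_4) (e : 'rV[R]_4) (a b u v : R) :
  open I -> open J -> meridian_data I J f g l -> I u -> J v ->
  minimal I J (meridian_surface f g l e) ->
  b = 1 \/ b = -1 ->
  inner (l v) (l v) = a -> inner (derive1 l v) (derive1 l v) = b ->
  inner (l v) (derive1 l v) = 0 ->
  inner (l v) e = 0 -> inner (derive1 l v) e = 0 ->
  derive1 f u ^+ 2 * a + derive1 g u ^+ 2 * inner e e = - b ->
  exists s t r, derive1 (derive1 l) v = s *: l v + t *: derive1 l v + r *: e.
Proof.
move=> oI oJ zS Iu Jv zmin b1 la lb lab le l'e fg.
set z := meridian_surface f g l e in zmin.
have [_ _ f0 _] := zS; have {f0} fu0 := f0 u Iu.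
have zu : 'D_(1, 0) z (u, v) = derive1 f u *: l v + derive1 g u *: e.
  exact: meridian_u zS Iu.
have zv c : 'D_(0, c) z (u, v) = (c * f u) *: derive1 l v.
  exact: meridian_v zS Jv.
have zuu : 'D_(1, 0) (fun q => 'D_(1, 0) z q) (u, v) =
    derive1 (derive1 f) u *: l v + derive1 (derive1 g) u *: e.
  exact: meridian_uu zS oI Iu.
have zvv c : 'D_(0, c) (fun q => 'D_(0, c) z q) (u, v) =
    (c ^+ 2 * f u) *: derive1 (derive1 l) v.
  exact: meridian_vv zS oJ Jv.
have uu : inner ('D_(1, 0) z (u, v)) ('D_(1, 0) z (u, v)) = - b.
  rewrite zu innerDl !innerDr !innerZl !innerZr (innerC e) le la -fg; ring.
have vv c : inner ('D_(0, c) z (u, v)) ('D_(0, c) z (u, v)) =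
    (c * f u) ^+ 2 * b.
  by rewrite zv innerZl innerZr lb; ring.
have uv c : inner ('D_(1, 0) z (u, v)) ('D_(0, c) z (u, v)) = 0.
  by rewrite zu zv innerDl !innerZl !innerZr lab (innerC e) l'e; ring.
have b0 : b != 0 by case: b1 => ->; rewrite ?oppr_eq0 oner_neq0.
(* The direction (0, c) gives the tangent vector l'. The number [c] is frozen at [u], as
   [second_form] extends fields with constant coefficients. *)
pose c := (f u)^-1; have cf : c * f u = 1 by rewrite mulVf.
(* The causal character of z_u depends on b, hence the order in the frame. *)
have hE : second_form z (u, v) (1, 0) (1, 0) =
    second_form z (u, v) (0, c) (0, c).
  have IJ : (I `*` J) (u, v) by [].
  have H0 x y : 2^-1 *: (x - y) = 0 :> 'rV[R]_4 -> x = y.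
    by move/eqP; rewrite scaler_eq0 invr_eq0 pnatr_eq0 /= subr_eq0 => /eqP.
  case: b1 => b1.
    have fr : orthonormal_frame z (u, v) (0, c) (1, 0).
      by split; [rewrite vv cf b1 expr1n mulr1|rewrite uu b1|rewrite innerC uv].
    by rewrite (H0 _ _ (zmin _ IJ _ _ fr)).
  have fr : orthonormal_frame z (u, v) (1, 0) (0, c).
    by split; [rewrite uu b1 opprK|rewrite vv cf b1 expr1n mul1r|rewrite uv].
  exact: H0 (zmin _ IJ _ _ fr).
(* [tangent_plane] is spanned by z_u and z_v, not z_v / f, so [vv] and [uv] are used with parameter
   1; there <z_v, z_v> = f^2 b is nonzero. *)
have TP w : w - normal_part z (u, v) w \in tangent_plane z (u, v).
  apply: sub_normal_part; [by rewrite uu oppr_eq0| |exact: uv].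
  by rewrite vv mul1r; exact: mulf_neq0 (expf_neq0 2 fu0) b0.
have TPu : 'D_(1, 0) (fun q => 'D_(1, 0) z q) (u, v) -
    second_form z (u, v) (1, 0) (1, 0) \in tangent_plane z (u, v) := TP _.
have TPv : 'D_(0, c) (fun q => 'D_(0, c) z q) (u, v) -
    second_form z (u, v) (0, c) (0, c) \in tangent_plane z (u, v) := TP _.
rewrite zuu in TPu; rewrite zvv in TPv.
(* The two equal normal parts cancel, and c^2 f = c: the vector f'' l + g'' e - c l'' equals s z_u +
   t z_v. *)
have := memvB TPu TPv; rewrite hE opprB subrKA.
move=> /mem_span2P[s [t]]; rewrite zu zv expr2 -mulrA cf mulr1 mul1r => E.
set f2 := derive1 (derive1 f) u in E; set g2 := derive1 (derive1 g) u in E.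
(* Obtained by solving [E] for c l'' and multiplying by f(u). *)
exists (f u * (f2 - s * derive1 f u)), (- (f u) ^+ 2 * t),
  (f u * (g2 - s * derive1 g u)).
apply/rowP => i; move: E => /rowP/(_ i); rewrite !mxE.
set L2 := derive1 (derive1 l) v 0 i; set L1 := derive1 l v 0 i.
set L := l v 0 i; set ei := e 0 i => E.
have cL2 : c * L2 = f2 * L + g2 * ei -
    (s * (derive1 f u * L + derive1 g u * ei) + t * (f u * L1)).
  by rewrite -E subKr.
have -> : L2 = f u * (c * L2) by rewrite mulrA (mulrC (f u)) cf mul1r.
by rewrite cL2; ring.
Qed.

(** * Constraints on the curve l and its planarity *)

Lemma inner_stdb_neq0 (R : realType) (k : 'I_4) :
  inner (stdb k) (stdb k : 'rV[R]_4) != 0.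
Proof.
have : k \in [:: 0; 1; 2; 3] by case: k => -[|[|[|[|]]]].
rewrite !inE => /or4P[] /eqP->; rewrite /inner !mxE /=;
  by rewrite ?(mulr0, mulr1, subr0, addr0, sub0r, add0r) ?oppr_eq0 oner_neq0.
Qed.

(** Differentiating <l, l> = a gives 2 <l, l'> = 0. It serves for l and again for l'. *)
Lemma inner_deriv_self (R : realType) (J : set R) (l : R -> 'rV[R]_4) (a v : R)
    (dl : 'rV[R]_4) :
  open J -> J v -> (forall t, J t -> inner (l t) (l t) = a) ->
  is_derive v 1 l dl -> inner (l v) dl = 0.
Proof.
move=> oJ Jv la dlv; have := derive_cst_on oJ Jv la (is_derive_inner dlv dlv).
rewrite (innerC dl) -mulr2n => /eqP; rewrite mulrn_eq0 /= => /eqP //.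
Qed.

Lemma coord_deriv0 (R : realType) (J : set R) (l : R -> 'rV[R]_4) (k : 'I_4)
    (v : R) (dl : 'rV[R]_4) :
  open J -> J v -> (forall t, J t -> l t 0 k = 0) ->
  is_derive v 1 l dl -> dl 0 k = 0.
Proof.
by move=> oJ Jv lk /is_derive_mxP/(_ 0 k); apply: derive_cst_on oJ Jv lk.
Qed.

(* The bivectors [x /\ y] and [x0 /\ y0] agree, hence so do their contractions
   with [w]. *)
Lemma inner_wedge (R : realType) (x y x0 y0 w : 'rV[R]_4) :
  (forall i j, x 0 i * y 0 j - x 0 j * y 0 i =
               x0 0 i * y0 0 j - x0 0 j * y0 0 i) ->
  inner y w *: x - inner x w *: y = inner y0 w *: x0 - inner x0 w *: y0.
Proof.
move=> xyE; apply/rowP => i; rewrite !mxE.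
pose p (a b : 'rV[R]_4) j := a 0 i * b 0 j - a 0 j * b 0 i.
have pE : p x y = p x0 y0 by apply/funext => j; exact: xyE.
transitivity (p x y 0 * w 0 0 + p x y 1 * w 0 1 - p x y 2 * w 0 2 -
              p x y 3 * w 0 3); first by rewrite /p /inner; ring.
by rewrite pE /p /inner; ring.
Qed.

(** The factor [s] may vary with [t] and has no known regularity, so l'' = s l is not solved as a
    differential equation; the constancy of l /\ l' is exploited instead. *)
Lemma planar_curve (R : realType) (J : set R) (l : R -> 'rV[R]_4) (b v0 v : R) :
  open_interval J -> smooth_on J l -> J v0 -> J v -> b != 0 ->
  (forall t, J t -> exists s, derive1 (derive1 l) t = s *: l t) ->
  inner (derive1 l v) (derive1 l v) = b -> inner (l v) (derive1 l v) = 0 ->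
  l v \in <<[:: l v0; derive1 l v0]>>%VS.
Proof.
move=> [_ Jitv _] lS Jv0 Jv b0 l2 lb lab.
pose m := derive1 l.
(* [l''] is parallel to [l], so the Pluecker coordinates of [l /\ l'] have zero
   derivative. *)
have wedge_cst i j : l v 0 i * m v 0 j - l v 0 j * m v 0 i =
    l v0 0 i * m v0 0 j - l v0 0 j * m v0 0 i.
  pose L i := fun t => l t 0 i; pose M i := fun t => m t 0 i.
  apply: (derive1_zero_cst (f := L i * M j - L j * M i) Jitv _ Jv Jv0) => t Jt.
  have /is_derive_mxP/(_ 0) dl := derive1_on lS Jt.
  have /is_derive_mxP/(_ 0) dm := derive1_on (smooth_on_derive1 lS) Jt.
  have dLM p q := is_deriveM (dl p) (dm q).
  apply: (is_derive_eq (is_deriveB (dLM i j) (dLM j i))).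
  have [s ->] := l2 t Jt; rewrite !mxE /GRing.scale /=.
  ring.
(* Contracting with l'(v) leaves b l(v) on the left, because l'(v) is orthogonal to l(v); the right
   side is a combination of l(v0) and l'(v0). *)
have := inner_wedge (derive1 l v) wedge_cst; rewrite lb lab scale0r subr0 => lE.
apply/mem_span2P; exists (b^-1 * inner (m v0) (derive1 l v)),
  (- (b^-1 * inner (l v0) (derive1 l v))).
by rewrite scaleNr -!scalerA -scalerBr -lE scalerA mulVf// scale1r.
Qed.

(** * The hyperplane containing the surface *)

Lemma meridian_hyperplane (R : realType) (I J : set R) (f g : R -> R)
    (l : R -> 'rV[R]_4) (k : 'I_4) (a b : R) :
  open_interval I -> open_interval J -> meridian_data I J f g l ->
  a != 0 -> b = 1 \/ b = -1 ->
  (forall v, J v -> [/\ l v 0 k = 0, inner (l v) (l v) = a &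
                       inner (derive1 l v) (derive1 l v) = b]) ->
  (forall u, I u -> derive1 f u ^+ 2 * a +
    derive1 g u ^+ 2 * inner (stdb k) (stdb k : 'rV[R]_4) = - b) ->
  minimal I J (meridian_surface f g l (stdb k)) ->
  exists P : set 'rV[R]_4, affine_hyperplane P /\
    meridian_surface f g l (stdb k) @` (I `*` J) `<=` P.
Proof.
move=> oiI oiJ zS a0 b1 lJ fgI zmin.
have [oI _ [u0 Iu0]] := oiI; have [oJ _ [v0 Jv0]] := oiJ.
have [_ _ _ lS] := zS.
have b0 : b != 0 by case: b1 => ->; rewrite ?oppr_eq0 oner_neq0.
have lk v : J v -> l v 0 k = 0 by case/lJ.
have la v : J v -> inner (l v) (l v) = a by case/lJ.
have lb v : J v -> inner (derive1 l v) (derive1 l v) = b by case/lJ.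
have dl v (Jv : J v) := derive1_on lS Jv.
have ddl v (Jv : J v) := derive1_on (smooth_on_derive1 lS) Jv.
have lab v (Jv : J v) := inner_deriv_self oJ Jv la (dl v Jv).
have l'k v (Jv : J v) := coord_deriv0 oJ Jv lk (dl v Jv).
have le v : J v -> inner (l v) (stdb k) = 0.
  by move=> Jv; rewrite inner_stdb lk// mul0r.
have l'e v : J v -> inner (derive1 l v) (stdb k) = 0.
  by move=> Jv; rewrite inner_stdb l'k// mul0r.
have l2 v : J v -> exists s, derive1 (derive1 l) v = s *: l v.
  move=> Jv.
  (* A single parameter [u0] suffices, since the conclusion concerns only l. *)
  have [s [t [r l2E]]] := minimal_meridian oI oJ zS Iu0 Jv zmin b1
    (la v Jv) (lb v Jv) (lab v Jv) (le v Jv) (l'e v Jv) (fgI u0 Iu0).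
  (* Pair with l': the result is t b on one side, and 0 on the other since <l', l'> is constant. *)
  have t0 : t = 0.
    have /eqP := inner_deriv_self oJ Jv lb (ddl v Jv).
    rewrite l2E !innerDr !innerZr (innerC _ (l v)) lab// lb// l'e// !mulr0.
    by rewrite add0r addr0 mulf_eq0 (negbTE b0) orbF => /eqP.
  (* Compare [k]-th coordinates: those of l, l' and l'' vanish, while that of [stdb k] is 1. *)
  have r0 : r = 0.
    have := coord_deriv0 oJ Jv l'k (ddl v Jv).
    by rewrite l2E !mxE lk// l'k// !eqxx !mulr0 !add0r mulr1.
  by exists s; rewrite l2E t0 r0 !scale0r !addr0.
pose W := <<[:: l v0; derive1 l v0; stdb k]>>%VS.
exists [set x | x - 0 \in W]; split.
  (* [free] unfolds to the equality of the dimension of the span with the number of vectors, here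
     3. *)
  exists 0, W; split=> //; apply/eqP; apply: free3_orthogonal.
  - by rewrite la.
  - by rewrite lb.
  - exact: inner_stdb_neq0.
  - exact: lab.
  - exact: le.
  - exact: l'e.
move=> _ [[u v] [/= Iu Jv] <-]; rewrite /meridian_surface /= subr0.
apply: memvD; apply: memvZ; last first.
  by apply: memv_span; rewrite !inE eqxx !orbT.
have := planar_curve oiJ lS Jv0 Jv b0 l2 (lb v Jv) (lab v Jv).
by apply/subvP/sub_span => x; rewrite !inE => /orP[] ->; rewrite ?orbT.
Qed.

(** * The six types *)

Lemma spacelike_axisE (R : realType) (f g : R -> R) (l : R -> 'rV[R]_4) :
  spacelike_axis f g l = meridian_surface f g l (stdb 0).
Proof. by apply/funext => q; rewrite /spacelike_axis addrC. Qed.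

Lemma curve_in_coord0 (R : realType) (J : set R) (X : seq 'rV[R]_4) (k : 'I_4)
    (a b : R) (l : R -> 'rV[R]_4) :
  (forall y, y \in X -> y 0 k = 0) -> curve_in J <<X>>%VS a b l ->
  forall v, J v -> [/\ l v 0 k = 0, inner (l v) (l v) = a &
                       inner (derive1 l v) (derive1 l v) = b].
Proof. by move=> X0 lJ v /lJ[/(span_coord0 X0)]. Qed.

(** With a = <l, l>, b = <l', l'> and e the axis vector, multiplying each profile equation by a =
    +-1 gives a f'^2 + <e, e> g'^2 = -b. Hence all six types are treated directly, without the
    metric-reversing coordinate map. *)
Lemma minimal_lorentz_meridian (R : realType) (I J : set R)
    (z : R * R -> 'rV[R]_4) :
  open_interval I -> open_interval J -> lorentz_meridian I J z ->
  minimal I J z ->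
  exists P : set 'rV[R]_4, affine_hyperplane P /\ z @` (I `*` J) `<=` P.
Proof.
move=> oI oJ zM.
have E31_0 y : y \in [:: stdb 0; stdb 1; stdb 2 : 'rV[R]_4] -> y 0 3 = 0.
  by rewrite !inE => /or3P[] /eqP->; rewrite mxE.
have E32_0 y : y \in [:: stdb 1; stdb 2; stdb 3 : 'rV[R]_4] -> y 0 0 = 0.
  by rewrite !inE => /or3P[] /eqP->; rewrite mxE.
have e3 : inner (stdb 3) (stdb 3 : 'rV[R]_4) = -1.
  by rewrite /inner !mxE /=; ring.
have e0 : inner (stdb 0) (stdb 0 : 'rV[R]_4) = 1.
  by rewrite /inner !mxE /=; ring.
have m1_neq0 : -1 != 0 :> R by rewrite oppr_eq0 oner_neq0.
have n1 : (1 : R) != 0 := oner_neq0 R.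
case: zM => f g l fgl lJ fg; rewrite ?spacelike_axisE.
- apply: (meridian_hyperplane oI oJ fgl n1 (or_introl erefl)
    (curve_in_coord0 E31_0 lJ)) => u Iu.
  by rewrite e3; have := fg u Iu; lra.
- apply: (meridian_hyperplane oI oJ fgl n1 (or_intror erefl)
    (curve_in_coord0 E31_0 lJ)) => u Iu.
  by rewrite e3; have := fg u Iu; lra.
- apply: (meridian_hyperplane oI oJ fgl m1_neq0 (or_introl erefl)
    (curve_in_coord0 E31_0 lJ)) => u Iu.
  by rewrite e3; have := fg u Iu; lra.
- apply: (meridian_hyperplane oI oJ fgl n1 (or_intror erefl)
    (curve_in_coord0 E32_0 lJ)) => u Iu.
  by rewrite e0; have := fg u Iu; lra.
- apply: (meridian_hyperplane oI oJ fgl m1_neq0 (or_introl erefl)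
    (curve_in_coord0 E32_0 lJ)) => u Iu.
  by rewrite e0; have := fg u Iu; lra.
- apply: (meridian_hyperplane oI oJ fgl m1_neq0 (or_intror erefl)
    (curve_in_coord0 E32_0 lJ)) => u Iu.
  by rewrite e0; have := fg u Iu; lra.
Qed.

Theorem corollary4 (R : realType) :
  (~ exists (I J : set R) (z : R * R -> 'rV[R]_4),
      [/\ open_interval I, open_interval J, lorentz_meridian I J z,
          minimal I J z & lies_fully (z @` (I `*` J))]) /\
  (forall (I J : set R) (z : R * R -> 'rV[R]_4),
      open_interval I -> open_interval J ->
      lorentz_meridian I J z -> minimal I J z ->
      exists P : set 'rV[R]_4,
        affine_hyperplane P /\ z @` (I `*` J) `<=` P).
Proof.
split; last exact: minimal_lorentz_meridian.
move=> [I [J [z [oI oJ zM zmin]]]]; apply.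
exact: minimal_lorentz_meridian oI oJ zM zmin.
Qed.
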